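(* Let $G$ be a simple connected graph with order $n(G)$ and size $m(G)$. Then $$W(G)\geq \varepsilon(G)+m(G)-n(G),$$ and equality holds if and only if $G$ is obtained from the complete graph $K_{n(G)}$ by removing a matching.
   Context: All graphs are finite, simple and connected. $n(G)$ and $m(G)$ denote the number of vertices and the number of edges of $G$. $d_G(u,v)$ is the number of edges on a shortest $u,v$-path. The Wiener index is $W(G)=\sum_{\{u,v\}\subseteq V(G)} d_G(u,v)$ (sum over unordered pairs of vertices). The eccentricity of a vertex $v$ is $\varepsilon_G(v)=\max_{u\in V(G)} d_G(v,u)$, and the eccentricity of the graph is $\varepsilon(G)=\sum_{v\in V(G)}\varepsilon_G(v)$. A matching is a (possibly empty) set of edges no two of which share an end-vertex; removing a matching means deleting its edges (keeping all vertices).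
   Formalization: The equality characterization is stated only for n(G) ≥ 2, because it fails for the one-vertex graph K_1 (W = 0 > −1 = ε + m − n, although K_1 is K_1 minus the empty matching); the inequality is stated for all G. *)

(* Defs.v *)
From mathcomp Require Import all_boot.

Set Implicit Arguments.
Unset Strict Implicit.
Unset Printing Implicit Defensive.

(* A simple graph on the vertex set T is a symmetric irreflexive relation
   e : rel T; both properties are hypotheses of the theorem. *)

Definition connected_graph (T : finType) (e : rel T) : Prop :=
  0 < #|T| /\ forall x y : T, connect e x y.

Definition graph_order (T : finType) (e : rel T) : nat := #|T|.

Definition edges (T : finType) (e : rel T) : {set {set T}} :=
  [set [set p.1; p.2] | p : T * T & e p.1 p.2].

Definition num_edges (T : finType) (e : rel T) : nat := #|edges e|.

(* p lists the vertices after u, so its length k is the number of edges. *)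
Definition has_path_of_length (T : finType) (e : rel T) (u v : T) (k : nat) :=
  [exists p : k.-tuple T, [&& path e u p, last u p == v & uniq (u :: p)]].

(* A path has fewer than #|T| edges, so the bound k < #|T| loses none, and the
   default value #|T| is returned only when no u,v-path exists. *)
Definition dist (T : finType) (e : rel T) (u v : T) : nat :=
  \big[minn/#|T|]_(k < #|T| | has_path_of_length e u v k) k.

(* Unordered pairs {u, v} of distinct vertices are listed once each by ordering
   T along its enumeration. *)
Definition wiener (T : finType) (e : rel T) : nat :=
  \sum_(u : T) \sum_(v : T | enum_rank u < enum_rank v) dist e u v.

Definition vertex_ecc (T : finType) (e : rel T) (v : T) : nat :=
  \max_(u : T) dist e v u.

Definition graph_ecc (T : finType) (e : rel T) : nat :=
  \sum_(v : T) vertex_ecc e v.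

Definition complete_graph (T : finType) : rel T := fun x y => x != y.

Definition is_matching (T : finType) (e : rel T) (M : {set {set T}}) : Prop :=
  M \subset edges e /\
  forall A B : {set T}, A \in M -> B \in M -> A != B -> [disjoint A & B].

Definition remove_edges (T : finType) (e : rel T) (M : {set {set T}}) : rel T :=
  fun x y => e x y && ([set x; y] \notin M).

Definition complete_minus_matching (T : finType) (e : rel T) : Prop :=
  exists2 M : {set {set T}},
    is_matching (@complete_graph T) M & e =2 remove_edges (@complete_graph T) M.

(* Main.v *)
Require Import Defs.
From mathcomp Require Import all_boot all_order all_algebra.
From mathcomp Require Import zify.

Set Implicit Arguments.
Unset Strict Implicit.
Unset Printing Implicit Defensive.

Import Order.TTheory GRing.Theory Num.Theory.

(** Doubling both sides, it suffices to show for every vertex [v] of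
    eccentricity [k] that the distances from [v] to its non-neighbours sum to
    at least [2 k - 2].  If [k >= 2], the sum contains a term [k]; if [k >= 3],
    it also contains a term [k - 1], the distance to the penultimate vertex of
    a shortest path to a farthest vertex, and the inequality is strict.
    Equality at [v] therefore means that [v] has at most one non-neighbour, and
    this holds at every vertex exactly when the complement is a matching. *)

Definition non_neighbours (T : finType) (e : rel T) (v : T) : {set T} :=
  [set u | (u != v) && ~~ e v u].

(** * Sums over ordered and unordered pairs *)

Lemma sum_sym_double (T : finType) (f : T -> T -> nat) :
    (forall u v, f u v = f v u) -> (forall u, f u u = 0) ->
  \sum_u \sum_v f u v = (\sum_u \sum_(v | enum_rank u < enum_rank v) f u v).*2.
Proof.
move=> f_sym f_diag; rewrite -addnn.
have split_row u : \sum_v f u v = \sum_(v | enum_rank u < enum_rank v) f u v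
    + \sum_(v | enum_rank v < enum_rank u) f u v.
  rewrite (bigID (fun v => enum_rank u < enum_rank v)) /=; congr (_ + _).
  rewrite (bigD1 u) ?ltnn //= f_diag add0n; apply: eq_bigl => v.
  by rewrite -leqNgt ltn_neqAle andbC -(inj_eq enum_rank_inj).
rewrite (eq_bigr _ (fun u _ => split_row u)) big_split; congr (_ + _).
rewrite (exchange_big_dep xpredT) //=; apply: eq_bigr => u _.
by apply: eq_bigr => v _; rewrite f_sym.
Qed.

Lemma num_edges_double (T : finType) (e : rel T) :
  symmetric e -> irreflexive e -> (num_edges e).*2 = \sum_u \sum_v (e u v : nat).
Proof.
move=> e_sym e_irr; rewrite sum_sym_double => [|u v|u]; last 2 first.
- by rewrite e_sym.
- by rewrite e_irr.
congr _.*2; rewrite pair_big_dep /= -big_mkcondr /= sum1dep_card.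
(* A rank-increasing pair is recovered from its two-element set, since swapping its entries would
   reverse the ranks; so such pairs can be counted by their images. *)
rewrite -(card_in_imset (f := fun p : T * T => [set p.1; p.2])); last first.
  move=> [a b] [c d]; rewrite !inE /= => /andP[ltab _] /andP[ltcd _] eq_set.
  have: a \in [set c; d] by rewrite -eq_set set21.
  have: b \in [set c; d] by rewrite -eq_set set22.
  rewrite !inE => /orP[]/eqP eb /orP[]/eqP ea; subst a b => //.
  - by rewrite ltnn in ltab.
  - by have := ltn_trans ltab ltcd; rewrite ltnn.
  - by rewrite ltnn in ltab.
apply: eq_card => A; apply/imsetP/imsetP => -[[a b]]; rewrite !inE /=.
- move=> eab ->; case: (ltngtP (enum_rank a) (enum_rank b)) => [ltab|ltba|].
  + by exists (a, b); rewrite // inE /= ltab.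
  + by exists (b, a); rewrite /= ?inE /= ?ltba 1?e_sym // setUC.
  + by move/ord_inj/enum_rank_inj => eq_ab; rewrite eq_ab e_irr in eab.
- by case/andP=> _ eab ->; exists (a, b); rewrite // inE.
Qed.

(** * Distances and shortest walks *)

Lemma bigminn_le (I : eqType) (i : I) (r : seq I) (P : pred I) (F : I -> nat)
    (d : nat) :
  i \in r -> P i -> \big[minn/d]_(j <- r | P j) F j <= F i.
Proof.
move=> + Pi; elim: r => //= j r IHr; rewrite inE big_cons => /orP[/eqP<-|/IHr le_i].
  by rewrite Pi geq_minl.
by case: ifP => // _; rewrite geq_min le_i orbT.
Qed.

(** [dist] minimises over repetition-free paths only. Shortening a walk gives one that is no longer,
    and having no repetition keeps its length below [#|T|]. *)
Lemma dist_le_size (T : finType) (e : rel T) (u v : T) (p : seq T) :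
  path e u p -> last u p = v -> dist e u v <= size p.
Proof.
move=> e_p; case/shortenP: e_p => q e_q uniq_q sub_qp last_q.
have lt_q : size q < #|T|.
  by have := max_card [in u :: q]; rewrite (card_uniqP uniq_q).
have le_qp : size q <= size p.
  by apply: uniq_leq_size => [|x /sub_qp //]; case/andP: uniq_q.
apply: leq_trans le_qp; apply: (@bigminn_le _ (Ordinal lt_q) _ _ (@nat_of_ord _)).
  exact: mem_index_enum.
by apply/existsP; exists (in_tuple q); rewrite /= e_q last_q eqxx.
Qed.

Lemma dist_attained (T : finType) (e : rel T) (u v : T) :
  connect e u v ->
  exists p, [/\ path e u p, last u p = v & size p = dist e u v].
Proof.
case/connectP=> p0 e_p0 last_p0.
have lt_dist : dist e u v < #|T|.
  case/shortenP: e_p0 last_p0 => q e_q uniq_q _ last_q.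
  apply: leq_ltn_trans (dist_le_size e_q (esym last_q)) _.
  by have := max_card [in u :: q]; rewrite (card_uniqP uniq_q).
(* Induction over the minimum has to allow for its default value [#|T|], which [lt_dist] then rules
   out. *)
suff [//|[p [e_p last_p size_p]]] : dist e u v = #|T| \/
    exists p, [/\ path e u p, last u p = v & size p = dist e u v].
- by move=> eq_T; rewrite eq_T ltnn in lt_dist.
- by exists p.
rewrite /dist; elim/big_ind: _ => [|a b Ha Hb|k]; first by left.
- by rewrite /minn; case: ifP.
- case/existsP=> p /and3P[e_p /eqP last_p _]; right.
  by exists p; rewrite size_tuple.
Qed.

Lemma distxx (T : finType) (e : rel T) (u : T) : dist e u u = 0.
Proof. by apply/eqP; rewrite -leqn0; apply: (@dist_le_size _ _ _ _ [::]). Qed.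

Section ConnectedGraph.

Variables (T : finType) (e : rel T).
Hypotheses (e_sym : symmetric e) (e_irr : irreflexive e).
Hypothesis e_conn : forall x y, connect e x y.

Lemma dist_sym (u v : T) : dist e u v = dist e v u.
Proof.
suff le_dist x y : dist e x y <= dist e y x.
  by apply/eqP; rewrite eqn_leq !le_dist.
have [p [e_p last_p <-]] := dist_attained (e_conn y x).
(* The walk is reversed: after [x] come the vertices of [y :: p] except the last, in reverse
   order. *)
rewrite -(size_belast y p) -size_rev; apply: dist_le_size.
  rewrite -last_p rev_path; apply: sub_path e_p => a b /=.
  by rewrite e_sym.
by case: p last_p {e_p} => //= z p _; rewrite rev_cons last_rcons.
Qed.

Lemma dist_adj (u v : T) : e u v -> dist e u v = 1.
Proof.
move=> e_uv; apply/eqP; rewrite eqn_leq (@dist_le_size _ _ _ _ [:: v]) /= ?e_uv //.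
have [[|x p] [_ /= last_p <-]] := dist_attained (e_conn u v) => //.
by rewrite last_p e_irr in e_uv.
Qed.

Lemma dist_gt0 (u v : T) : (0 < dist e u v) = (u != v).
Proof.
case: eqVneq => [->|neq_uv]; first by rewrite distxx.
have [[|x p] [_ /= last_p <-]] := dist_attained (e_conn u v) => //.
by rewrite last_p eqxx in neq_uv.
Qed.

Lemma mem_non_neighbours (u v : T) : (u \in non_neighbours e v) = (1 < dist e v u).
Proof.
rewrite inE; case: (boolP (e v u)) => [/dist_adj ->|nadj]; rewrite ?andbF // andbT.
have := dist_gt0 v u.
have [[|x [|y p]] [/= e_p last_p <-]] := dist_attained (e_conn v u) => //=.
- by rewrite eq_sym.
- by case/andP: e_p nadj; rewrite last_p => ->.
- by rewrite eq_sym.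
Qed.

(** The penultimate vertex of a shortest path works: a shorter walk to it, extended by the last
    edge, would reach [w] in fewer than [k.+1] steps. *)
Lemma dist_pred (v w : T) (k : nat) :
  dist e v w = k.+1 -> exists x, dist e v x = k.
Proof.
have [p [e_p last_p size_p]] := dist_attained (e_conn v w).
case/lastP: p e_p last_p size_p => [_ _ <- //|p z].
rewrite rcons_path last_rcons size_rcons => /andP[e_p e_z] z_w size_p.
rewrite -size_p => -[<-]; rewrite {}z_w in e_z.
exists (last v p).
have [q [e_q last_q size_q]] := dist_attained (e_conn v (last v p)).
apply/eqP; rewrite eqn_leq dist_le_size //= -ltnS.
rewrite -size_q -(size_rcons q w) size_p.
by apply: dist_le_size; rewrite ?last_rcons // rcons_path e_q last_q.
Qed.

(** * Distance sums over the non-neighbours of a vertex *)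

Lemma sum_dist_non_neighbours (v : T) :
  \sum_u dist e v u =
  \sum_u (e v u : nat) + \sum_(u in non_neighbours e v) dist e v u.
Proof.
rewrite [X in _ = _ + X]big_mkcond -big_split /=; apply: eq_bigr => u _ /=.
rewrite inE; case: (boolP (e v u)) => [/dist_adj -> |_] /=; first by rewrite andbF.
by case: eqVneq => [->|]; rewrite ?distxx.
Qed.

Lemma ecc_non_neighbours (v : T) : 1 < #|T| ->
  (vertex_ecc e v).*2 <= \sum_(u in non_neighbours e v) dist e v u + 2
    ?= iff (#|non_neighbours e v| <= 1).
Proof.
move=> T_gt1; set N := non_neighbours e v.
have dist_le_ecc u : dist e v u <= vertex_ecc e v by exact: leq_bigmax.
have [w] := bigop.eq_bigmax (dist e v) (ltnW T_gt1); rewrite -/(vertex_ecc e v) => ecc_w.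
have ecc_gt0 : 0 < vertex_ecc e v.
  have /card_gt0P[u] : 0 < #|[set~ v]| by rewrite cardsC1; lia.
  by rewrite !inE eq_sym -dist_gt0 => /leq_trans; apply.
(* At eccentricity 1, [N] is empty and both sides are 2. *)
case: (leqP (vertex_ecc e v) 1) => [ecc_le1|ecc_gt1].
  have N0 : N = set0.
    apply/setP=> u; rewrite mem_non_neighbours inE ltnNge.
    by rewrite (leq_trans (dist_le_ecc u)).
  have -> : vertex_ecc e v = 1 by lia.
  by rewrite N0 big_set0 cards0.
have w_N : w \in N by rewrite mem_non_neighbours -ecc_w.
rewrite (big_setD1 w) //= -ecc_w (cardsD1 w) w_N /= ltnS leqn0 cards_eq0.
have [x dist_x] : exists x, dist e v x = (vertex_ecc e v).-1.
  by apply: (@dist_pred v w); rewrite -ecc_w prednK.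
have x_N : 2 < vertex_ecc e v -> x \in N :\ w.
  move=> ecc_gt2; rewrite in_setD1 mem_non_neighbours dist_x andbC.
  apply/andP; split; first lia.
  by apply/eqP=> eq_xw; move: dist_x; rewrite eq_xw -ecc_w; lia.
(* If [w] is the only non-neighbour, [x_N] forces eccentricity 2, and equality holds. *)
case: (set_0Vmem (N :\ w)) => [N0|[y y_N]].
  have ecc2 : vertex_ecc e v = 2.
    by case: (ltnP 2 (vertex_ecc e v)) => [/x_N|]; [rewrite N0 inE | lia].
  by rewrite N0 big_set0 eqxx ecc2.
have /negPf -> : N :\ w != set0 by apply/set0Pn; exists y.
(* The term of [w] cancels one eccentricity. For the other, [x] supplies all but 1 of it when it
   exceeds 2, and otherwise [y] supplies at least 2; the summand 2 makes both cases strict. *)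
suff : vertex_ecc e v < \sum_(u in N :\ w) dist e v u + 2.
  by move=> lt_ecc; split; [|apply/negbTE]; lia.
case: (ltnP 2 (vertex_ecc e v)) => [/x_N {}x_N|ecc_le2].
  by rewrite (big_setD1 x) //= dist_x; lia.
have : 1 < dist e v y by rewrite -mem_non_neighbours; case/setD1P: y_N.
by rewrite (big_setD1 y) //=; lia.
Qed.

(** * Summation over all vertices *)

Lemma wiener_double :
  (wiener e).*2 = (num_edges e).*2
    + \sum_v \sum_(u in non_neighbours e v) dist e v u.
Proof.
rewrite -sum_sym_double; [|exact: dist_sym|exact: distxx].
rewrite num_edges_double // -big_split.
by apply: eq_bigr => v _; exact: sum_dist_non_neighbours.
Qed.

Lemma ecc_edges_leqif_wiener : 1 < #|T| ->
  graph_ecc e + num_edges e <= wiener e + #|T|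
    ?= iff [forall v, #|non_neighbours e v| <= 1].
Proof.
move=> T_gt1.
have [le_sum eq_sum] := leqif_sum (fun v (_ : xpredT v) => ecc_non_neighbours v T_gt1).
move: le_sum eq_sum; rewrite big_split sum_nat_const -[#|xpredT|]/#|T| /=.
have -> : \sum_v (vertex_ecc e v).*2 = (graph_ecc e).*2.
  by rewrite -mul2n big_distrr; apply: eq_bigr => v _; rewrite -mul2n.
(* [S] is twice the difference of [wiener e] and [num_edges e], and the constant 2 per vertex adds
   up to twice [#|T|]. *)
have := wiener_double; set S := \sum_v _; move=> W2 le_sum eq_sum.
split; first lia.
by apply: etrans eq_sum; apply/eqP/eqP; lia.
Qed.

End ConnectedGraph.

(** * Complements that are matchings *)

Lemma complete_minus_matchingP (T : finType) (e : rel T) :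
    symmetric e -> irreflexive e ->
  complete_minus_matching e <-> forall v, #|non_neighbours e v| <= 1.
Proof.
move=> e_sym e_irr; split=> [[M [_ disjM] eM] v|few].
  have in_M u : u \in non_neighbours e v -> [set v; u] \in M.
    rewrite inE eM /remove_edges /complete_graph eq_sym.
    by case/andP=> ->; rewrite negbK.
  apply/card_le1_eqP=> x y x_N y_N.
  (* Two removed edges at [v] are not disjoint, so they coincide. *)
  have [eq_set|/(disjM _ _ (in_M x x_N) (in_M y y_N))] :=
    eqVneq [set v; x] [set v; y].
    have : x \in [set v; y] by rewrite -eq_set set22.
    by move: x_N; rewrite !inE => /andP[/negPf-> _] /eqP.
  by move/disjoint_setI0/setP/(_ v); rewrite !inE eqxx.
have few_eq v x y : x != v -> ~~ e v x -> y != v -> ~~ e v y -> x = y.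
  by move=> xv nx yv ny; apply: (card_le1_eqP (few v)); rewrite inE ?xv ?yv.
(* The matching to remove is the edge set of the complement. *)
pose co_e : rel T := fun x y => (x != y) && ~~ e x y.
have co_sym : symmetric co_e by move=> x y; rewrite /co_e eq_sym e_sym.
have co_edge x y : ([set x; y] \in edges co_e) = co_e x y.
  apply/imsetP/idP=> [[[a b]]|co_xy]; last by exists (x, y); rewrite ?inE.
  rewrite inE /= => co_ab eq_set.
  have neq_xy : x != y.
    have := cards2 x y; rewrite eq_set cards2; case/andP: co_ab => -> _.
    by case: (x != y).
  move: (set22 x y) (set21 x y) neq_xy; rewrite eq_set.
  by move=> /set2P[]-> /set2P[]->; rewrite ?eqxx // co_sym.
exists (edges co_e); last first.
  move=> x y; rewrite /remove_edges co_edge /co_e /complete_graph.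
  by case: eqVneq => [->|]; rewrite ?e_irr //= negbK.
split.
  apply/subsetP=> A /imsetP[[a b]]; rewrite inE /= => /andP[neq_ab _] ->.
  by apply/imsetP; exists (a, b); rewrite ?inE.
(* Two complement edges meeting at [z] can both be written from [z]; their other ends are
   non-neighbours of [z], hence equal by [few_eq]. *)
have edge_at A z : A \in edges co_e -> z \in A ->
    exists2 u, co_e z u & A = [set z; u].
  case/imsetP=> -[a b]; rewrite inE /= => co_ab ->; rewrite !inE.
  case/orP=> /eqP->; first by exists b.
  by exists a; rewrite 1?co_sym // setUC.
move=> A B A_co B_co; apply: contraNT; rewrite -setI_eq0 => /set0Pn[z].
case/setIP=> /(edge_at _ _ A_co)[x /andP[zx nx] ->].
case/(edge_at _ _ B_co)=> y /andP[zy ny] ->.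
by rewrite (few_eq z x y) // eq_sym.
Qed.

(** Equality is characterised from two vertices on: the one-vertex graph is complete, yet its Wiener
    index is 0 and the right-hand side is -1. *)
Theorem theorem2p1 (T : finType) (e : rel T)
    (e_sym : symmetric e) (e_irr : irreflexive e)
    (e_conn : connected_graph e) :
  ((wiener e)%:Z >= (graph_ecc e)%:Z + (num_edges e)%:Z - (graph_order e)%:Z)%R /\
  (1 < graph_order e ->
    ((wiener e)%:Z = (graph_ecc e)%:Z + (num_edges e)%:Z - (graph_order e)%:Z)%R <->
    complete_minus_matching e).
Proof.
case: e_conn => T_gt0 conn; rewrite /graph_order; split; last first.
  move=> T_gt1; have [_ eq_W] := ecc_edges_leqif_wiener e_sym e_irr conn T_gt1.
  rewrite complete_minus_matchingP //; split=> [W_eq|few].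
    by apply/forallP; rewrite -eq_W; apply/eqP; lia.
  by move/forallP: few; rewrite -eq_W => /eqP; lia.
case: (ltnP 1 #|T|) => [T_gt1|T_le1].
  by have [le_W _] := ecc_edges_leqif_wiener e_sym e_irr conn T_gt1; lia.
(* On a single vertex the eccentricity and the size vanish, so the right-hand side is negative. *)
have T_eq (x y : T) : x = y by apply: (fintype_le1P T_le1).
have ecc0 : graph_ecc e = 0.
  rewrite /graph_ecc big1 // => v _; apply/eqP; rewrite -leqn0.
  by apply/bigmax_leqP=> u _; rewrite (T_eq u v) distxx.
have : (num_edges e).*2 = 0.
  rewrite num_edges_double // big1 // => u _; rewrite big1 // => v _.
  by rewrite (T_eq u v) e_irr.
by rewrite ecc0; lia.
Qed.
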